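(* Let $\alpha\in(0,1)$. Suppose the time-step ratios satisfy $1\le \rho_n\le \rho^*(\alpha)$ for all $n\ge 2$ (including $\rho_{N+1}$), where $\rho^*(\alpha)$ (an upper bound exceeding $\overline\rho\approx 4.7476114$) is as defined in the context. For $n\ge 1$ let $\mathcal G$ be the non-negative functional $$\mathcal G[\nabla_\tau w^n]=\frac{\alpha\,\rho_{n+1}^{2-\alpha/2}(\nabla_\tau w^n)^2}{2(1+\rho_{n+1})\tau_n^\alpha\Gamma(3-\alpha)}+\frac12\sum_{j=1}^{n-1}\left(J^{(n)}_{n-j-1}-J^{(n)}_{n-j}\right)(w^n-w^j)^2+\frac12 J^{(n)}_{n-1}(w^n-w^0)^2 .$$ Then for every real sequence $(w^k)_{k=0}^N$ and every $2\le n\le N$, $$\left(D^\alpha_\tau w^n\right)\nabla_\tau w^n\ \ge\ \mathcal G[\nabla_\tau w^n]-\mathcal G[\nabla_\tau w^{n-1}]+\frac{q(\rho_n,\rho_{n+1},\alpha)\,(\nabla_\tau w^n)^2}{2\tau_n^\alpha\,\Gamma(3-\alpha)} .$$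
   Context: Time mesh: $0=t_0<t_1<\dots<t_N=T$, $\tau_k=t_k-t_{k-1}$, $\rho_k=\tau_k/\tau_{k-1}\ge1$ for $k\ge2$. The number $\rho_{N+1}$ (ratio of a possible further step to $\tau_N$) is any number satisfying the same constraint. For a sequence $(w^k)$, $\nabla_\tau w^k=w^k-w^{k-1}$. For $1\le k\le n$, $$c^{(n)}_{n-k}=\frac{(t_n-t_{k-1})^{1-\alpha}-(t_n-t_k)^{1-\alpha}}{\tau_k\Gamma(2-\alpha)},$$ $$d^{(n)}_{n-k}=\frac{2[(t_n-t_{k-1})^{2-\alpha}-(t_n-t_k)^{2-\alpha}]}{\tau_k^2\Gamma(3-\alpha)}-\frac{(t_n-t_{k-1})^{1-\alpha}+(t_n-t_k)^{1-\alpha}}{\tau_k\Gamma(2-\alpha)}.$$ Discrete (L2) Caputo derivative: $D^\alpha_\tau w^1=c^{(1)}_0\nabla_\tau w^1$ and, for $n\ge2$, $$D^\alpha_\tau w^n=\sum_{k=1}^n c^{(n)}_{n-k}\nabla_\tau w^k+\frac{\rho_n}{1+\rho_n}d^{(n)}_0\left[\nabla_\tau w^n-\rho_n\nabla_\tau w^{n-1}\right]+\sum_{k=1}^{n-1}d^{(n)}_{n-k}\frac{\nabla_\tau w^{k+1}-\rho_{k+1}\nabla_\tau w^k}{\rho_{k+1}(1+\rho_{k+1})}.$$ Constants: put $$q_2(\rho,\alpha)=\frac{1+\rho}{\alpha}+\rho-\rho^{2-\alpha/2}+2^{-\alpha}\alpha+\frac12-\alpha,$$ $$q_3(\rho,\alpha)=\alpha\ln\rho-2\,\frac{1+\rho-2^{-\alpha}\alpha^2+2^{-\alpha}\alpha^3\ln2+\alpha^2}{1+\rho+\alpha\rho+2^{-\alpha}\alpha^2+\frac{\alpha}{2}-\alpha^2}.$$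 $\rho^*(\alpha)$ is the unique root $\rho\ge1$ of $q_2(\rho,\alpha)=0$. $\overline\rho\approx4.7476114$ is the $\rho$-component of the solution $(\rho,\alpha)\approx(4.7476114,0.82265)$ of $q_2=q_3=0$. Set $$\theta=\frac1{2-\alpha}+\frac{2^{1-\alpha}\alpha^2+\alpha-2\alpha^2}{2(2-\alpha)(1+\overline\rho)},$$ $$q(z,y,\alpha)=2\theta(2-\alpha)+\frac{2\alpha z-\alpha z^{2-\alpha/2}}{1+z}-\frac{\alpha y^{2-\alpha/2}}{1+y}.$$ Kernels: $\widetilde c^{(1)}_0=(1-\theta)c^{(1)}_0$. For $n\ge2$: $\widetilde c^{(n)}_{n-1}=c^{(n)}_{n-1}-\frac{d^{(n)}_{n-1}}{1+\rho_2}$, $\widetilde c^{(n)}_0=(1-\theta)c^{(n)}_0+\frac{d^{(n)}_1}{\rho_n(1+\rho_n)}$, and $\widetilde c^{(n)}_{n-k}=c^{(n)}_{n-k}+\frac{d^{(n)}_{n-k+1}}{\rho_k(1+\rho_k)}-\frac{d^{(n)}_{n-k}}{1+\rho_{k+1}}$ for $2\le k\le n-1$. Finally $J^{(n)}_0=2\widetilde c^{(n)}_0$ and $J^{(n)}_{n-k}=\widetilde c^{(n)}_{n-k}$ for $1\le k\le n-1$. *)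

(* Defs.v *)
From mathcomp Require Import all_boot all_order all_algebra.
From mathcomp Require Import all_classical all_reals all_analysis.

Set Implicit Arguments.
Unset Strict Implicit.
Unset Printing Implicit Defensive.

Import Order.TTheory GRing.Theory Num.Theory.
Import numFieldNormedType.Exports.

Local Open Scope classical_set_scope.
Local Open Scope ring_scope.

(* Euler's integral of the second kind; only used at arguments s > 1. *)
Definition Gamma (R : realType) (s : R) : R :=
  \int[lebesgue_measure]_(x in `[0, +oo[) (x `^ (s - 1) * expR (- x)).

Definition q2 (R : realType) (rho alpha : R) : R :=
  (1 + rho) / alpha + rho - rho `^ (2 - alpha / 2)
  + 2 `^ (- alpha) * alpha + 1 / 2 - alpha.

Definition q3 (R : realType) (rho alpha : R) : R :=
  alpha * ln rho
  - 2 * ((1 + rho - 2 `^ (- alpha) * alpha ^+ 2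
            + 2 `^ (- alpha) * alpha ^+ 3 * ln 2 + alpha ^+ 2)
         / (1 + rho + alpha * rho + 2 `^ (- alpha) * alpha ^+ 2
            + alpha / 2 - alpha ^+ 2)).

(* For 0 < alpha < 1 the map q2 (-) alpha is concave, positive at 1 and tends
   to -oo, so it has exactly one root in [1, +oo[. *)
Definition is_rho_star (R : realType) (alpha rstar : R) : Prop :=
  1 <= rstar /\ q2 rstar alpha = 0.

(* The numerical windows only single out the intended solution of
   q2 = q3 = 0; the decimals 4.7476114 and 0.82265 are truncated values
   (the solution is 4.74761145..., 0.822652...). *)
Definition is_rho_bar (R : realType) (rbar : R) : Prop :=
  exists a : R,
    [/\ q2 rbar a = 0, q3 rbar a = 0,
        `|rbar - (4 + 747 / 10 ^+ 3 + 611 / 10 ^+ 6 + 4 / 10 ^+ 7)| < 1 / 10 ^+ 7 &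
        `|a - (822 / 10 ^+ 3 + 65 / 10 ^+ 5)| < 1 / 10 ^+ 5].

Definition theta (R : realType) (rbar alpha : R) : R :=
  1 / (2 - alpha)
  + (2 `^ (1 - alpha) * alpha ^+ 2 + alpha - 2 * alpha ^+ 2)
    / (2 * (2 - alpha) * (1 + rbar)).

Definition q (R : realType) (rbar z y alpha : R) : R :=
  2 * theta rbar alpha * (2 - alpha)
  + (2 * alpha * z - alpha * z `^ (2 - alpha / 2)) / (1 + z)
  - alpha * y `^ (2 - alpha / 2) / (1 + y).

(* Backward difference: nabla w k = w^k - w^(k-1), and the time step is
   tau_k = nabla t k. Only used for k >= 1. *)
Definition nabla (R : realType) (w : nat -> R) (k : nat) : R := w k - w k.-1.

Definition time_mesh (R : realType) (T : R) (N : nat) (t : nat -> R) : Prop :=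
  [/\ t 0%N = 0, t N = T & forall k, (k < N)%N -> t k < t k.+1].

(* rho N.+1, the ratio of a possible further step, is left unspecified. *)
Definition step_ratios (R : realType) (N : nat) (t rho : nat -> R) : Prop :=
  forall k, (2 <= k <= N)%N -> rho k = nabla t k / nabla t k.-1.

(* In c_coef, d_coef, ctilde and J below, the arguments n m stand for the
   superscript (n) and the subscript m, with 0 <= m <= n - 1; the mesh index
   k of c^(n)_{n-k} is recovered as k = n - m. *)
Definition c_coef (R : realType) (alpha : R) (t : nat -> R) (n m : nat) : R :=
  let k := (n - m)%N in
  ((t n - t k.-1) `^ (1 - alpha) - (t n - t k) `^ (1 - alpha))
  / (nabla t k * Gamma (2 - alpha)).

Definition d_coef (R : realType) (alpha : R) (t : nat -> R) (n m : nat) : R :=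
  let k := (n - m)%N in
  2 * ((t n - t k.-1) `^ (2 - alpha) - (t n - t k) `^ (2 - alpha))
    / (nabla t k ^+ 2 * Gamma (3 - alpha))
  - ((t n - t k.-1) `^ (1 - alpha) + (t n - t k) `^ (1 - alpha))
    / (nabla t k * Gamma (2 - alpha)).

Definition caputo_L2 (R : realType) (alpha : R) (t rho w : nat -> R)
    (n : nat) : R :=
  if n == 1%N then c_coef alpha t 1 0 * nabla w 1 else
  \sum_(1 <= k < n.+1) c_coef alpha t n (n - k) * nabla w k
  + rho n / (1 + rho n) * d_coef alpha t n 0
    * (nabla w n - rho n * nabla w n.-1)
  + \sum_(1 <= k < n) d_coef alpha t n (n - k)
      * ((nabla w k.+1 - rho k.+1 * nabla w k)
         / (rho k.+1 * (1 + rho k.+1))).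

Definition ctilde (R : realType) (alpha rbar : R) (t rho : nat -> R)
    (n m : nat) : R :=
  let k := (n - m)%N in
  if n == 1%N then (1 - theta rbar alpha) * c_coef alpha t 1 0
  else if m == n.-1 then
    c_coef alpha t n m - d_coef alpha t n m / (1 + rho 2%N)
  else if m == 0%N then
    (1 - theta rbar alpha) * c_coef alpha t n 0
    + d_coef alpha t n 1 / (rho n * (1 + rho n))
  else
    c_coef alpha t n m + d_coef alpha t n m.+1 / (rho k * (1 + rho k))
    - d_coef alpha t n m / (1 + rho k.+1).

Definition J (R : realType) (alpha rbar : R) (t rho : nat -> R)
    (n m : nat) : R :=
  if m == 0%N then 2 * ctilde alpha rbar t rho n 0
  else ctilde alpha rbar t rho n m.

(* energy n is G[nabla_tau w^n]. *)
Definition energy (R : realType) (alpha rbar : R) (t rho w : nat -> R)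
    (n : nat) : R :=
  alpha * rho n.+1 `^ (2 - alpha / 2) * nabla w n ^+ 2
    / (2 * (1 + rho n.+1) * nabla t n `^ alpha * Gamma (3 - alpha))
  + 1 / 2 * \sum_(1 <= j < n)
      (J alpha rbar t rho n (n - j - 1) - J alpha rbar t rho n (n - j))
      * (w n - w j) ^+ 2
  + 1 / 2 * J alpha rbar t rho n n.-1 * (w n - w 0%N) ^+ 2.

(* Main.v *)
(* Write v_k = w^k - w^(k-1). Regrouping the L2 formula by v_k gives
     D w^n = sum_k ctilde_{n-k} v_k + theta c_0 v_n
             + rho_n / (1 + rho_n) d_0 (v_n - rho_n v_(n-1)).
   The last two terms yield the local part of the energy by completing a square.
   For the first one, summation by parts gives
     2 v_n sum_k ctilde_{n-k} v_k
       = sum_j A^n_j ((w^n - w^j)^2 - (w^(n-1) - w^j)^2),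
   where A^n_j = J^(n)_{n-j-1} - J^(n)_{n-j} and A^n_0 = J^(n)_{n-1}, so it
   suffices that 0 <= A^n_j <= A^(n-1)_j. As a function of the distance to t_n,
   the kernel x^(-alpha) is nonnegative, nonincreasing and convex, which for
   ratios >= 1 sandwiches
     g (t_n - t_(k-1)) <= ctilde_{n-k} <= g (t_n - t_k)
   and gives A^n_j >= 0; the kernel g - g (_ + h) has the same properties, which
   gives the monotonicity in n. The cells touching t_n, where g is singular, are
   covered by the explicit value of theta. *)

Require Import Defs.
From mathcomp Require Import all_boot all_order all_algebra.
From mathcomp Require Import all_classical all_reals all_analysis.
From mathcomp Require Import measurable_realfun ring lra zify.

Set Implicit Arguments.
Unset Strict Implicit.
Unset Printing Implicit Defensive.

Import Order.TTheory GRing.Theory Num.Theory.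
Import numFieldNormedType.Exports.

Local Open Scope classical_set_scope.
Local Open Scope ring_scope.

(** * Euler's Gamma function *)

Section gamma.
Context {R : realType}.
Implicit Types (r s p x : R).
Local Notation mu := (@lebesgue_measure R).

Lemma integrable_mull (D : set (measurableTypeR R)) (k : R) (f : R -> R) :
  measurable D -> mu.-integrable D (EFin \o f) ->
  mu.-integrable D (EFin \o (fun x => k * f x)).
Proof. by move=> mD h; have := integrableZl mD k h. Qed.

Lemma integrable_sub (D : set (measurableTypeR R)) (f g : R -> R) :
  measurable D ->
  mu.-integrable D (EFin \o f) -> mu.-integrable D (EFin \o g) ->
  mu.-integrable D (EFin \o (fun x => f x - g x)).
Proof. by move=> mD hf hg; have := integrableB mD hf hg. Qed.

Lemma cvg_expRN r : 0 < r -> expR (- (r * x)) @[x --> +oo] --> (0 : R).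
Proof.
move=> r0; apply: (@cvg_comp _ _ _ (fun z => r * z) (fun x => expR (- x)) _
  (pinfty_nbhs R)); last exact: cvgr_expR.
exact: gt0_cvgMry.
Qed.

Lemma is_derive_expRN r x :
  is_derive x 1 (fun x => expR (- (r * x))) (- r * expR (- (r * x))).
Proof.
apply: is_derive_eq.
by rewrite /GRing.scale/=; ring.
Qed.

Lemma continuous_expRN r : continuous (fun x : R => expR (- (r * x))).
Proof.
move=> x; apply: differentiable_continuous; apply/derivable1_diffP.
exact: ex_derive.
Qed.

Lemma integral_expRN r : 0 < r ->
  (\int[mu]_(x in `[0%R, +oo[) (expR (- (r * x)))%:E = r^-1%:E)%E.
Proof.
move=> r0.
rewrite (@ge0_continuous_FTC2y _ _ (fun x => - r^-1 * (expR (- (r * x)))) _ 0)//.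
- by rewrite mulr0 oppr0 expR0 mulr1 -EFinB sub0r opprK.
- exact/continuous_subspaceT/continuous_expRN.
- rewrite -[X in _ --> X](mulr0 (- r^-1)); apply: cvgMr => //; exact: cvg_expRN.
- apply: cvg_at_right_filter; apply: cvgMr; exact: continuous_expRN.
- move=> x _; rewrite derive1E deriveZ//=.
  have [_ ->] := is_derive_expRN r x.
  by rewrite /GRing.scale/= mulrA mulrNN mulVf ?gt_eqF ?mul1r.
Qed.

Lemma integrable_expRN r : 0 < r ->
  mu.-integrable `[0, +oo[ (EFin \o (fun x => expR (- (r * x)))).
Proof.
move=> r0; apply/integrableP; split.
  apply/measurable_EFinP/measurable_funTS; apply: continuous_measurable_fun.
  exact: continuous_expRN.
under eq_integral do rewrite /= ger0_norm ?expR_ge0//.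
by rewrite integral_expRN// ltry.
Qed.

(** Since e^(x/2) >= 1 + x^2/8, the right side dominates x^2 for x >= 1 and 1 for x < 1. It serves
    as majorant for the Gamma integrands. *)
Lemma powR_le_expR p x : 0 <= p <= 2 -> 0 <= x -> x `^ p <= 8 * expR (x / 2).
Proof.
move=> /andP[p0 p2] x0.
have x20 : 0 <= x / 2 by rewrite divr_ge0.
have e1 : 1 + (x / 2) ^+ 2 / 2 <= expR (x / 2) := expR_ge1Dxn 1 x20.
have [x1|x1] := leP 1 x.
  apply: (@le_trans _ _ (x ^+ 2)).
    by rewrite -powR_mulrn//; apply: ler_powR.
  nra.
apply: (@le_trans _ _ 1); last by nra.
have <- : 1 `^ p = 1 :> R by rewrite powR1.
  by apply: ge0_ler_powR => //; rewrite ?nnegrE// ltW.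
Qed.

Lemma integrable_powR_expR p : 0 <= p <= 2 ->
  mu.-integrable `[0, +oo[ (EFin \o (fun x => x `^ p * expR (- x))).
Proof.
move=> p02.
have i2 : 0 < 2^-1 :> R by [].
have i8 : mu.-integrable `[0, +oo[ (EFin \o (fun x => 8 * expR (- (2^-1 * x)))).
  by apply: integrable_mull => //; exact: integrable_expRN.
apply: le_integrable i8 => //=.
  apply/measurable_EFinP; apply: measurable_funM; apply: measurable_funTS.
    exact: measurable_powR.
  apply: continuous_measurable_fun.
  by have := @continuous_expRN 1; under eq_fun do rewrite mul1r.
move=> x; rewrite in_itv/= andbT => x0.
rewrite lee_fin !ger0_norm ?mulr_ge0 ?powR_ge0 ?expR_ge0//.
have -> : expR (- (2^-1 * x)) = expR (x / 2) * expR (- x).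
  by rewrite -expRD; congr expR; field.
by rewrite mulrA ler_wpM2r ?expR_ge0 ?powR_le_expR.
Qed.

(** As 1 - e^(-x) <= min(1, x) <= x^(s-1), the integrand is at least e^(-x) - e^(-2x), whose
    integral is 1/2. *)
Lemma Gamma_gt0 s : 1 < s <= 2 -> 0 < Gamma s.
Proof.
move=> /andP[s1 s2].
have i1 := integrable_expRN (@ltr01 R).
have i2 := integrable_expRN (ltr0Sn R 1).
have e12 : \int[mu]_(x in `[0%R, +oo[)
    (expR (- (1 * x)) - expR (- (2 * x))) = 1 - 2^-1.
  by rewrite RintegralB// /Rintegral !integral_expRN//= invr1.
apply: (@lt_le_trans _ _ (1 - 2^-1)); first by lra.
rewrite -e12; apply: le_Rintegral => //.
- exact: integrable_sub.
- apply: integrable_powR_expR; lra.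
- move=> x; rewrite /= in_itv/= andbT => x0.
  have -> : expR (- (1 * x)) - expR (- (2 * x)) = (1 - expR (- x)) * expR (- x).
    rewrite mulrBl mul1r -expRD mul1r; congr (_ - expR _); ring.
  rewrite ler_wpM2r ?expR_ge0//.
  have e1 := expR_ge1Dx (- x); have e0 := expR_gt0 (- x).
  have [x1|x1] := leP 1 x.
    apply: (@le_trans _ _ 1); first by lra.
    by rewrite -[leLHS](powRr0 x) ler_powR// subr_ge0 ltW.
  move: x0; rewrite le_eqVlt => /predU1P[<-|x0].
    by rewrite oppr0 expR0 subrr powR_ge0.
  apply: (@le_trans _ _ x); first by lra.
  by rewrite -[leLHS]powRr1 ?(ltW x0)// ger_powR ?x0 ?(ltW x1)//; lra.
Qed.

Lemma cvg_powR_expR p : 0 <= p <= 2 ->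
  x `^ p * expR (- x) @[x --> +oo] --> (0 : R).
Proof.
move=> p02.
have i2 : 0 < 2^-1 :> R by [].
apply: (@squeeze_cvgr _ _ _ _ (fun=> 0) (fun x => 8 * expR (- (2^-1 * x)))).
- near=> x; have x0 : 0 <= x by near: x; exact: nbhs_pinfty_ge.
  rewrite mulr_ge0 ?powR_ge0 ?expR_ge0//=.
  have -> : expR (- (2^-1 * x)) = expR (x / 2) * expR (- x).
    by rewrite -expRD; congr expR; field.
  by rewrite mulrA ler_wpM2r ?expR_ge0 ?powR_le_expR.
- exact: cvg_cst.
- rewrite -[X in _ --> X](mulr0 8); apply: cvgMr; exact: cvg_expRN.
Unshelve. all: by end_near. Qed.

(* Integrating the derivative of [- x `^ s * expR (- x)] needs a sign: the term
   [16 * expR (- x / 2)] makes the integrand nonnegative. *)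
Lemma GammaD1 s : 1 < s <= 2 -> Gamma (s + 1) = s * Gamma s.
Proof.
move=> /andP[s1 s2]; rewrite /Gamma addrK.
have i2 : 0 < 2^-1 :> R by [].
pose u x := x `^ s * expR (- x); pose v x := x `^ (s - 1) * expR (- x).
pose e x := expR (- (2^-1 * x)).
have iu : mu.-integrable `[0, +oo[ (EFin \o u).
  by apply: integrable_powR_expR; lra.
have iv : mu.-integrable `[0, +oo[ (EFin \o v).
  by apply: integrable_powR_expR; lra.
have ie : mu.-integrable `[0, +oo[ (EFin \o e) by exact: integrable_expRN.
have isv : mu.-integrable `[0, +oo[ (EFin \o (fun x => s * v x)).
  exact: integrable_mull.
have i16 : mu.-integrable `[0, +oo[ (EFin \o (fun x => 16 * e x)).
  exact: integrable_mull.
have iuv : mu.-integrable `[0, +oo[ (EFin \o (fun x => u x - s * v x)).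
  exact: integrable_sub.
(* The integrand is the derivative of - u - 32 e, which goes from -32 at 0 to 0 at infinity. The
   auxiliary term alone integrates to 32 and cancels at the end. *)
have : \int[mu]_(x in `[0%R, +oo[) (u x - s * v x + 16 * e x) = 0 - (- 32).
  have F0 : - u 0 - 32 * e 0 = - 32.
    by rewrite /u /e powR0 ?mulr0 ?oppr0 ?expR0; lra.
  rewrite -F0.
  have cv0e : e x @[x --> 0^'+] --> e 0.
    by apply: cvg_at_right_filter; exact: continuous_expRN.
  have cv0 (p : R) : 0 < p ->
      x `^ p * expR (- x) @[x --> 0^'+] --> 0 `^ p * expR (- 0).
    move=> p0; apply: cvgM.
      by rewrite powR0 ?gt_eqF//; exact: powR_cvg0.
    apply: cvg_at_right_filter.
    suff : continuous (fun x : R => expR (- x)) by exact.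
    by have := @continuous_expRN 1; under eq_fun do rewrite mul1r.
  have dF x : 0 < x ->
      is_derive x 1 (fun x => - u x - 32 * e x) (u x - s * v x + 16 * e x).
    move=> x0; have ? := is_derive1_powR s x0.
    rewrite /u /v /e; apply: is_derive_eq.
    by rewrite /GRing.scale/=; field.
  apply: (@Rintegral_ge0_continuous_FTC2y _ _ (fun x => - u x - 32 * e x)).
  - move=> x x0; suff : s * v x <= 16 * e x.
      have : 0 <= u x by rewrite mulr_ge0 ?powR_ge0 ?expR_ge0.
      lra.
    have -> : e x = expR (x / 2) * expR (- x).
      by rewrite /e -expRD; congr expR; field.
    rewrite mulrA mulrA ler_wpM2r ?expR_ge0//.
    have := @powR_le_expR (s - 1) x; move=> /(_ _ x0) => H.
    have {}H : x `^ (s - 1) <= 8 * expR (x / 2) by apply: H; lra.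
    have := powR_ge0 x (s - 1); nra.
  - apply/continuous_within_itvcyP; split.
      move=> x; rewrite in_itv/= andbT => x0.
      apply: differentiable_continuous; apply/derivable1_diffP.
      have ? := is_derive1_powR s x0; have ? := is_derive1_powR (s - 1) x0.
      by rewrite /u /v /e; exact: ex_derive.
    apply: cvgD; last by apply: cvgMr; exact: cv0e.
    by apply: cvgB; [|apply: cvgMr]; apply: cv0; lra.
  - rewrite -[X in _ --> X](subr0 0) -[X in _ --> X - _]oppr0.
    rewrite -[X in _ --> _ - X](mulr0 32).
    apply: cvgB; first by apply: cvgN; apply: cvg_powR_expR; lra.
    by apply: cvgMr; exact: cvg_expRN.
  - by move=> x x0; have [] := dF x x0.
  - apply: cvgB; first by apply: cvgN; apply: cv0; lra.
    by apply: cvgMr; exact: cv0e.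
  - move=> x; rewrite in_itv/= andbT => x0; rewrite derive1E.
    by have [_ ->] := dF x x0.
rewrite RintegralD// RintegralB// RintegralZl// RintegralZl//.
rewrite [X in 16 * X](_ : _ = 2); last first.
  by rewrite /Rintegral integral_expRN//= invrK.
lra.
Qed.

End gamma.

(** * Moments of convex kernels *)

Section convex.
Context {R : realType}.
Implicit Types (F f g k G H : R -> R) (x y z u v : R).

Lemma derive_ge0_le F f (a b : R) : a <= b ->
  (forall x, a <= x <= b -> is_derive x 1 F (f x)) ->
  (forall x, a <= x <= b -> 0 <= f x) -> F a <= F b.
Proof.
move=> ab dF f0.
have dF' x : x \in `]a, b[%R -> is_derive x 1 F (f x).
  by rewrite in_itv/= => /andP[ax xb]; apply: dF; rewrite !ltW.
have cF : {within `[a, b], continuous F}.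
  apply: continuous_in_subspaceT => x; rewrite inE/= in_itv/= => xab.
  apply: differentiable_continuous; apply/derivable1_diffP.
  by have [] := dF _ xab.
have [c cab FE] := MVT_segment ab dF' cF.
rewrite -subr_ge0 FE mulr_ge0 ?subr_ge0//.
by apply: f0; move: cab; rewrite in_itv.
Qed.

(* [k] is the opposite of the derivative of [g], so that [g] is nonnegative,
   nonincreasing and convex; [G] and [H] are iterated antiderivatives of [g]. *)
Definition convex_kernel k g G H :=
  [/\ (forall x, 0 < x -> is_derive x 1 H (G x)),
      (forall x, 0 < x -> is_derive x 1 G (g x)),
      (forall x, 0 < x -> is_derive x 1 g (- k x)),
      (forall x, 0 < x -> 0 <= g x /\ 0 <= k x) &
      (forall x y, 0 < x -> x <= y -> k y <= k x)].

(* The coefficients c and d of a cell whose distance to t_n ranges over [x, y]: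
   the mean of [g] over the cell, and its first moment about the midpoint. *)
Definition cell_c G (x y : R) := (G y - G x) / (y - x).
Definition cell_d G H (x y : R) :=
  2 * (H y - H x) / (y - x) ^+ 2 - (G y + G x) / (y - x).

Section kernel.
Variables k g G H : R -> R.
Hypothesis gP : convex_kernel k g G H.

Lemma convex_kernel_nincr (x y : R) : 0 < x -> x <= y -> g y <= g x.
Proof.
move=> x0 xy; have [_ _ dg gk _] := gP.
rewrite -lerN2; apply: (@derive_ge0_le (fun u => - g u) k) => // u /andP[xu _].
  have u0 := lt_le_trans x0 xu; have ? := dg _ u0.
  by apply: is_derive_eq; rewrite opprK.
by have [] := gk _ (lt_le_trans x0 xu).
Qed.

Section cell.
Variables x y : R.
Hypotheses (x0 : 0 < x) (xy : x < y).

Let y_x : 0 < y - x. Proof. by rewrite subr_gt0. Qed.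
Let gt0 (u : R) : x <= u -> 0 < u. Proof. exact: lt_le_trans. Qed.

(** Numerator of [cell_d] as a function of the far end u. It vanishes at x with its first
    derivative, and its second derivative is (u - x) k(u). *)
Let moment (u : R) := 2 * (H u - H x) - (u - x) * (G u + G x).

Let cell_dE : cell_d G H x y = moment y / (y - x) ^+ 2.
Proof. by rewrite /cell_d /moment; field; rewrite gt_eqF. Qed.

Let is_derive_moment (u : R) : x <= u ->
  is_derive u 1 moment (G u - G x - (u - x) * g u).
Proof.
move=> xu; have [dH dG _ _ _] := gP.
have ? := dH _ (gt0 xu); have ? := dG _ (gt0 xu).
by rewrite /moment; apply: is_derive_eq; rewrite /GRing.scale/=; ring.
Qed.

(** Integrate twice from x: the second derivative of the bracket is (u - x)(k(u) - c). The sign s =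
    1 or -1 covers lower and upper bounds at once. *)
Let moment_cubic (c s : R) : (forall u, x <= u <= y -> 0 <= s * (k u - c)) ->
  0 <= s * (moment y - c * (y - x) ^+ 3 / 6).
Proof.
move=> sc; have [dH dG dg _ _] := gP.
have P0 : s * (moment x - c * (x - x) ^+ 3 / 6) = 0.
  by rewrite /moment !subrr; ring.
rewrite -[leLHS]P0; apply: (@derive_ge0_le
  (fun u => s * (moment u - c * (u - x) ^+ 3 / 6))
  (fun u => s * (G u - G x - (u - x) * g u - c * (u - x) ^+ 2 / 2))).
- exact: ltW.
- move=> u /andP[xu _]; have ? := is_derive_moment xu.
  by apply: is_derive_eq; rewrite /GRing.scale/=; field.
move=> u /andP[xu uy].
have Q0 : s * (G x - G x - (x - x) * g x - c * (x - x) ^+ 2 / 2) = 0.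
  by rewrite !subrr; ring.
rewrite -[leLHS]Q0; apply: (@derive_ge0_le
  (fun u => s * (G u - G x - (u - x) * g u - c * (u - x) ^+ 2 / 2))
  (fun u => (u - x) * (s * (k u - c)))) => //.
- move=> v /andP[xv _]; have ? := dG _ (gt0 xv); have ? := dg _ (gt0 xv).
  by apply: is_derive_eq; rewrite /GRing.scale/=; field.
- move=> v /andP[xv vu]; rewrite mulr_ge0 ?subr_ge0//.
  by apply: sc; rewrite xv (le_trans vu).
Qed.

Lemma cell_d_lower : k y * (y - x) / 6 <= cell_d G H x y.
Proof.
have [_ _ _ _ kn] := gP.
have := @moment_cubic (k y) 1; rewrite !mul1r => H1.
have {}H1 : 0 <= moment y - k y * (y - x) ^+ 3 / 6.
  apply: H1 => u /andP[xu uy]; rewrite mul1r subr_ge0.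
  exact: kn (gt0 xu) uy.
rewrite cell_dE ler_pdivlMr ?exprn_gt0//.
apply: le_trans (_ : k y * (y - x) ^+ 3 / 6 <= _).
  by rewrite le_eqVlt; apply/orP; left; apply/eqP; field.
by rewrite -subr_ge0.
Qed.

Lemma cell_d_upper : cell_d G H x y <= k x * (y - x) / 6.
Proof.
have [_ _ _ _ kn] := gP.
have : 0 <= -1 * (moment y - k x * (y - x) ^+ 3 / 6).
  apply: moment_cubic => u /andP[xu uy]; rewrite mulN1r oppr_ge0 subr_le0.
  exact: kn xu.
rewrite mulN1r oppr_ge0 subr_le0 => H1.
rewrite cell_dE ler_pdivrMr ?exprn_gt0//; apply: le_trans H1 _.
by rewrite le_eqVlt; apply/orP; left; apply/eqP; field.
Qed.

Lemma cell_d_ge0 : 0 <= cell_d G H x y.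
Proof.
have [_ _ _ gk _] := gP.
apply: le_trans cell_d_lower; rewrite divr_ge0 ?mulr_ge0 ?(ltW y_x)//.
by have [] := gk y (gt0 (ltW xy)).
Qed.

(** Multiplied by (u - x)^2, the difference of the sides vanishes at u = x and has derivative (u -
    x)^2 k(u) >= 0 in the far end u. *)
Lemma cell_cBd_ge : g y + cell_d G H x y <= cell_c G x y.
Proof.
have [_ dG dg gk _] := gP.
have : 0 <= (y - x) * (G y - G x) - (y - x) ^+ 2 * g y - moment y.
  have P0 : (x - x) * (G x - G x) - (x - x) ^+ 2 * g x - moment x = 0.
    by rewrite /moment !subrr; ring.
  rewrite -[leLHS]P0; apply: (@derive_ge0_le
    (fun u => (u - x) * (G u - G x) - (u - x) ^+ 2 * g u - moment u)
    (fun u => (u - x) ^+ 2 * k u)); first exact: ltW.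
  - move=> u /andP[xu _]; have ? := is_derive_moment xu.
    have ? := dG _ (gt0 xu); have ? := dg _ (gt0 xu).
    by apply: is_derive_eq; rewrite /GRing.scale/=; ring.
  - by move=> u /andP[xu _]; rewrite mulr_ge0 ?sqr_ge0//;
    have [] := gk u (gt0 xu).
rewrite cell_dE -(pmulr_rge0 _ (_ : 0 < (y - x) ^- 2)) ?invr_gt0 ?exprn_gt0//.
move=> P_ge0; rewrite -subr_ge0; apply: le_trans P_ge0 _.
by rewrite le_eqVlt /cell_c; apply/orP; left; apply/eqP; field; rewrite gt_eqF.
Qed.

(** Same scheme; the derivative is now 2((u - x) g(x) - (G(u) - G(x))), nonnegative because [g] is
    nonincreasing. *)
Lemma cell_cDd_le : cell_c G x y + cell_d G H x y <= g x.
Proof.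
have [_ dG dg gk _] := gP.
have : 0 <= (y - x) ^+ 2 * g x - (y - x) * (G y - G x) - moment y.
  have P0 : (x - x) ^+ 2 * g x - (x - x) * (G x - G x) - moment x = 0.
    by rewrite /moment !subrr; ring.
  rewrite -[leLHS]P0; apply: (@derive_ge0_le
    (fun u => (u - x) ^+ 2 * g x - (u - x) * (G u - G x) - moment u)
    (fun u => 2 * ((u - x) * g x - (G u - G x)))); first exact: ltW.
  - move=> u /andP[xu _]; have ? := is_derive_moment xu.
    have ? := dG _ (gt0 xu).
    by apply: is_derive_eq; rewrite /GRing.scale/=; ring.
  - move=> u /andP[xu _]; rewrite mulr_ge0//.
    have Q0 : (x - x) * g x - (G x - G x) = 0 by rewrite !subrr; ring.
    rewrite -[leLHS]Q0; apply: (@derive_ge0_le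
      (fun u => (u - x) * g x - (G u - G x)) (fun u => g x - g u)) => //.
    + move=> v /andP[xv _]; have ? := dG _ (gt0 xv).
      by apply: is_derive_eq; rewrite /GRing.scale/=; ring.
    + by move=> v /andP[xv _]; rewrite subr_ge0 convex_kernel_nincr.
rewrite cell_dE -(pmulr_rge0 _ (_ : 0 < (y - x) ^- 2)) ?invr_gt0 ?exprn_gt0//.
move=> P_ge0; rewrite -subr_ge0; apply: le_trans P_ge0 _.
by rewrite le_eqVlt /cell_c; apply/orP; left; apply/eqP; field; rewrite gt_eqF.
Qed.

(** The trapezoidal rule overestimates the mean of a convex function. *)
Lemma cell_c_trapezoid : cell_c G x y <= (g x + g y) / 2.
Proof.
have [_ dG dg gk kn] := gP.
have : 0 <= (y - x) * (g x + g y) / 2 - (G y - G x).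
  have P0 : (x - x) * (g x + g x) / 2 - (G x - G x) = 0 by rewrite !subrr; ring.
  rewrite -[leLHS]P0; apply: (@derive_ge0_le
    (fun u => (u - x) * (g x + g u) / 2 - (G u - G x))
    (fun u => (g x - g u - (u - x) * k u) / 2)); first exact: ltW.
  - move=> u /andP[xu _]; have ? := dG _ (gt0 xu); have ? := dg _ (gt0 xu).
    by apply: is_derive_eq; rewrite /GRing.scale/=; field.
  - move=> u /andP[xu _]; rewrite divr_ge0//.
    (* The tangent to [g] at u lies below [g] at x. *)
    suff : - g x - k u * x <= - g u - k u * u.
      by rewrite -subr_ge0; congr (0 <= _); ring.
    apply: (@derive_ge0_le (fun v => - g v - k u * v)
      (fun v => k v - k u)) => //.
    + move=> v /andP[xv _]; have ? := dg _ (gt0 xv).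
      by apply: is_derive_eq; rewrite /GRing.scale/=; ring.
    + by move=> v /andP[xv vu]; rewrite subr_ge0 kn// gt0.
rewrite /cell_c ler_pdivrMr//; lra.
Qed.

End cell.

(** Both moments are compared with k(y)/6 times the width, y being the common endpoint. *)
Lemma cell_d_nincr (x y z : R) : 0 < x -> x < y -> y < z -> z - y <= y - x ->
  cell_d G H y z <= cell_d G H x y.
Proof.
move=> x0 xy yz zy; have y0 := lt_trans x0 xy.
apply: le_trans (cell_d_upper y0 yz) _; apply: le_trans (cell_d_lower x0 xy).
rewrite ler_wpM2r// ler_wpM2l//.
by have [_ _ _ gk _] := gP; have [] := gk y y0.
Qed.

End kernel.
End convex.

(** * Decrements of a kernel under a shift of the final time *)

Section shift.
Context {R : realType}.
Implicit Types (F f g k G H : R -> R) (x y z u v h : R).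

Lemma is_derive_shift F l x h :
  is_derive (x + h) 1 F l -> is_derive x 1 (fun y => F (y + h)) l.
Proof.
move=> dF; rewrite -(mulr1 l).
apply: (@is_derive1_comp _ F (fun y => y + h)).
by apply: is_derive_eq; rewrite addr0.
Qed.

(* Moving t_n forward by [h] turns a kernel [g] into [g (_ + h)], so the loss of
   a coefficient is the same coefficient for the kernel [decrement g h]. *)
Definition decrement F h x := F x - F (x + h).

Lemma is_derive_decrement F f h : 0 <= h ->
  (forall x, 0 < x -> is_derive x 1 F (f x)) ->
  forall x, 0 < x -> is_derive x 1 (decrement F h) (decrement f h x).
Proof.
move=> h0 dF x x0.
have ? := dF _ x0; have /is_derive_shift ? := dF _ (ltr_wpDr h0 x0).
by rewrite /decrement; apply: is_derive_eq.
Qed.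

(** Signs follow from the monotonicity of [g] and [k]. Monotonicity of the new [k] is of the nature
    of convexity of [k], which [convex_kernel] does not contain; hence the last hypothesis. *)
Lemma convex_kernel_decrement k g G H h : 0 <= h -> convex_kernel k g G H ->
  (forall x y, 0 < x -> x <= y -> decrement k h y <= decrement k h x) ->
  convex_kernel (decrement k h) (decrement g h) (decrement G h) (decrement H h).
Proof.
move=> h0 gP kh; have [dH dG dg gk kn] := gP; split=> //.
- exact: is_derive_decrement.
- exact: is_derive_decrement.
- move=> x x0.
  have -> : - decrement k h x = decrement (fun x => - k x) h x.
    by rewrite /decrement; ring.
  by apply: is_derive_decrement.
- move=> x x0; rewrite /decrement !subr_ge0.
  have xh : x <= x + h by rewrite lerDl.
  by rewrite kn//; split => //; exact: (convex_kernel_nincr gP).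
Qed.

Lemma cell_c_decrement G h x y :
  cell_c (decrement G h) x y = cell_c G x y - cell_c G (x + h) (y + h).
Proof. by rewrite /cell_c /decrement (_ : y + h - (x + h) = y - x); ring. Qed.

Lemma cell_d_decrement G H h x y :
  cell_d (decrement G h) (decrement H h) x y =
  cell_d G H x y - cell_d G H (x + h) (y + h).
Proof. by rewrite /cell_d /decrement (_ : y + h - (x + h) = y - x); ring. Qed.

End shift.

(** * The kernel [x `^ (- alpha)] *)

Section power_kernel.
Context {R : realType}.
Implicit Types (x y h s : R).

Lemma is_derive_scale_powR s (a b c : R) x : 0 < x -> b = a * c -> s = c - 1 ->
  is_derive x 1 (fun y => a * y `^ c) (b * x `^ s).
Proof.
move=> x0 -> ->; have ? := is_derive1_powR c x0.
by apply: is_derive_eq; rewrite /GRing.scale/=; ring.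
Qed.

Lemma powR_nincr s x y : s <= 0 -> 0 < x -> x <= y -> y `^ s <= x `^ s.
Proof.
move=> s0 x0 xy; rewrite -[s]opprK !(powRN _ (- s)).
rewrite lef_pV2 ?posrE ?powR_gt0//; last exact: lt_le_trans xy.
by rewrite ge0_ler_powR ?oppr_ge0 ?nnegrE ?(ltW x0)// ltW// (lt_le_trans x0).
Qed.

Lemma powR_decrement_nincr s h x y : s <= 0 -> 0 <= h -> 0 < x -> x <= y ->
  decrement (fun z => z `^ s) h y <= decrement (fun z => z `^ s) h x.
Proof.
move=> s0 h0 x0 xy; rewrite -lerN2.
apply: (@derive_ge0_le _ (fun u => - decrement (fun z => z `^ s) h u)
  (fun u => - s * decrement (fun z => z `^ (s - 1)) h u)) => //.
- move=> u /andP[xu _]; have u0 := lt_le_trans x0 xu.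
  have ? := is_derive_decrement h0 (fun x => @is_derive1_powR R s x) u0.
  by apply: is_derive_eq; rewrite /decrement; ring.
- move=> u /andP[xu _]; have u0 := lt_le_trans x0 xu.
  rewrite mulr_ge0 ?oppr_ge0// subr_ge0 powR_nincr ?lerDl//.
  by rewrite subr_le0 (le_trans s0).
Qed.

Variable alpha : R.
Hypothesis alpha01 : 0 < alpha < 1.

(** The kernel x^(-alpha) / Gamma(1 - alpha) scaled by Gamma(3 - alpha), so that [c_coef] and
    [d_coef] become [cell_c] and [cell_d] divided by Gamma(3 - alpha). *)
Definition pow_k x := alpha * (1 - alpha) * (2 - alpha) * x `^ (- alpha - 1).
Definition pow_g x := (1 - alpha) * (2 - alpha) * x `^ (- alpha).
Definition pow_G x := (2 - alpha) * x `^ (1 - alpha).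
Definition pow_H x := x `^ (2 - alpha).

Lemma pow_kernel : convex_kernel pow_k pow_g pow_G pow_H.
Proof.
have /andP[a0 a1] := alpha01.
split=> [x x0|x x0|x x0|x x0|x y x0 xy].
- have ? := is_derive1_powR (2 - alpha) x0.
  by apply: is_derive_eq; rewrite /pow_G; congr (_ * _ `^ _); ring.
- by apply: is_derive_scale_powR => //; ring.
- by rewrite -mulNr; apply: is_derive_scale_powR => //; ring.
- rewrite /pow_k /pow_g.
  by rewrite !mulr_ge0 ?powR_ge0// ?subr_ge0 ltW// (lt_trans a1)// ltr1n.
- rewrite /pow_k ler_wpM2l ?powR_nincr//; last by lra.
  by rewrite !mulr_ge0// ?subr_ge0 ltW// (lt_trans a1)// ltr1n.
Qed.

Lemma pow_kernel_decrement h : 0 <= h -> convex_kernel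
  (decrement pow_k h) (decrement pow_g h) (decrement pow_G h) (decrement pow_H h).
Proof.
have /andP[a0 a1] := alpha01.
move=> h0; apply: convex_kernel_decrement pow_kernel _ => // x y x0 xy.
rewrite /decrement /pow_k -!mulrBr ler_wpM2l//.
  by rewrite !mulr_ge0// ?subr_ge0 ltW// (lt_trans a1)// ltr1n.
by apply: powR_decrement_nincr => //; lra.
Qed.

(** e^(4/5) >= (1 + 1/5)^4 > 2. *)
Lemma ln2_le : ln 2 <= 4 / 5 :> R.
Proof.
rewrite -(ler_expR) lnK ?posrE//.
have -> : 4 / 5 = 5^-1 + 5^-1 + (5^-1 + 5^-1) :> R by field.
have := expR_ge1Dx (5^-1 : R); rewrite !expRD.
set e := expR _ => e1.
have e2 : 36 / 25 <= e * e by nra.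
nra.
Qed.

Lemma powR2N_ge : 1 - 4 / 5 * alpha <= 2 `^ (- alpha).
Proof.
have /andP[a0 a1] := alpha01.
rewrite /powR gt_eqF//; apply: le_trans (expR_ge1Dx _).
have := ln2_le; nra.
Qed.

(** The concave function u^(1-alpha) stays below its tangent at 1; take u = 2. *)
Lemma powR2_le : 2 `^ (1 - alpha) <= 2 - alpha.
Proof.
have /andP[a0 a1] := alpha01.
have : (1 - alpha) * 1 - 1 `^ (1 - alpha) <= (1 - alpha) * 2 - 2 `^ (1 - alpha).
  apply: (@derive_ge0_le _ (fun u : R => (1 - alpha) * u - u `^ (1 - alpha))
    (fun u => (1 - alpha) * (1 - u `^ (- alpha)))).
  - by rewrite ler1n.
  - move=> u /andP[u1 _]; have u0 : 0 < u := lt_le_trans ltr01 u1.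
    have ? := is_derive1_powR (1 - alpha) u0.
    apply: is_derive_eq; rewrite /GRing.scale/= addrAC subrr add0r; ring.
  - move=> u /andP[u1 _]; rewrite mulr_ge0 ?subr_ge0 ?(ltW a1)//.
    by rewrite -[leRHS](powRr0 u) ler_powR// oppr_le0 ltW.
rewrite powR1; lra.
Qed.

End power_kernel.

(** * Summation by parts *)

Section summation.
Context {R : realType}.
Implicit Types (a w : nat -> R) (n : nat).

(** Sequences start at index 1 and count as 0 at index 0. For [mesh_J n] the increments are thus the
    weights A^n_j, including A^n_0, up to Gamma(3 - alpha). *)
Definition increments a j := a j.+1 - (if j is 0%N then 0 else a j).

Lemma sum_increments a n : \sum_(0 <= j < n.+1) increments a j = a n.+1.
Proof.
elim: n => [|n IH]; first by rewrite big_nat1 /increments subr0.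
by rewrite big_nat_recr//= IH /increments addrC subrK.
Qed.

(** Abel summation, then 2v(w^(n+1) - w^j) = (w^(n+1) - w^j)^2 - (w^n - w^j)^2 + v^2 with v the last
    difference. The extra squares add up to the last term, which accounts for the factor 2 in
    J^(n)_0. *)
Lemma sum_nabla_by_parts a w n :
  2 * nabla w n.+1 * \sum_(1 <= k < n.+2) a k * nabla w k =
  \sum_(0 <= j < n.+1) increments a j * ((w n.+1 - w j) ^+ 2 - (w n - w j) ^+ 2)
  + a n.+1 * nabla w n.+1 ^+ 2.
Proof.
have -> : \sum_(1 <= k < n.+2) a k * nabla w k =
    \sum_(0 <= j < n.+1) increments a j * (w n.+1 - w j).
  elim: n => [|n IH]; first by rewrite !big_nat1 /increments subr0.
  rewrite big_nat_recr//= IH -(sum_increments a n.+1) mulr_suml.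
  have -> : \sum_(0 <= j < n.+1) increments a j * (w n.+1 - w j) =
      \sum_(0 <= j < n.+2) increments a j * (w n.+1 - w j).
    by rewrite [RHS]big_nat_recr//= subrr mulr0 addr0.
  by rewrite -big_split/=; apply: eq_bigr => j _; rewrite /nabla/=; ring.
rewrite -(sum_increments a n) mulr_suml mulr_sumr -big_split/=.
apply: eq_bigr => j _; rewrite /nabla/=; ring.
Qed.

End summation.

(** * Convolution kernels on the mesh *)

Section mesh.
Context {R : realType}.
Variables (N : nat) (t rho : nat -> R).
Hypothesis t_incr : forall k, (k < N)%N -> t k < t k.+1.
Hypothesis rhoE : step_ratios N t rho.
Hypothesis rho_ge1 : forall k, (2 <= k <= N.+1)%N -> 1 <= rho k.

Lemma mesh_lt i j : (i < j <= N)%N -> t i < t j.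
Proof.
elim: j => // j IH /andP[ij jN].
move: ij; rewrite ltnS leq_eqVlt => /predU1P[->|ij]; first exact: t_incr.
by apply: lt_trans (t_incr jN); apply: IH; rewrite ij ltnW.
Qed.

Lemma nabla_gt0 k : (0 < k <= N)%N -> 0 < nabla t k.
Proof. by case: k => // k /andP[_ kN]; rewrite subr_gt0 t_incr. Qed.

Lemma nabla_le k : (0 < k < N)%N -> nabla t k <= nabla t k.+1.
Proof.
move=> /andP[k0 kN]; have k2 : (2 <= k.+1 <= N)%N by lia.
have tk : 0 < nabla t k by apply: nabla_gt0; lia.
have := rho_ge1 (k := k.+1); rewrite rhoE// => /(_ _)/wrap[]; first by lia.
by rewrite /= ler_pdivlMr// mul1r.
Qed.

Definition mesh_c G n k := cell_c G (t n - t k) (t n - t k.-1).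
Definition mesh_d G H n k := cell_d G H (t n - t k) (t n - t k.-1).
(** What the second difference attached to cell k - 1 passes on to v_k; the first cell has no
    predecessor. *)
Definition mesh_e G H n k :=
  if (2 <= k)%N then mesh_d G H n k.-1 / (rho k * (1 + rho k)) else 0.
Definition mesh_ct G H n k :=
  mesh_c G n k + mesh_e G H n k - mesh_d G H n k / (1 + rho k.+1).

Lemma mesh_c_decrement G n k :
  mesh_c (decrement G (nabla t n.+1)) n k = mesh_c G n k - mesh_c G n.+1 k.
Proof.
by rewrite /mesh_c cell_c_decrement; congr (_ - cell_c _ _ _); rewrite /nabla/=; ring.
Qed.

Lemma mesh_d_decrement G H n k :
  mesh_d (decrement G (nabla t n.+1)) (decrement H (nabla t n.+1)) n k =
  mesh_d G H n k - mesh_d G H n.+1 k.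
Proof.
by rewrite /mesh_d cell_d_decrement; congr (_ - cell_d _ _ _ _); rewrite /nabla/=; ring.
Qed.

Lemma mesh_e_decrement G H n k :
  mesh_e (decrement G (nabla t n.+1)) (decrement H (nabla t n.+1)) n k =
  mesh_e G H n k - mesh_e G H n.+1 k.
Proof.
rewrite /mesh_e mesh_d_decrement; case: ifP => _; last by rewrite subr0.
by rewrite mulrBl.
Qed.

(** [mesh_ct] is linear in the kernel, so every bound proved for convex kernels also bounds the loss
    of a coefficient when n grows by one. *)
Lemma mesh_ct_decrement G H n k :
  mesh_ct (decrement G (nabla t n.+1)) (decrement H (nabla t n.+1)) n k =
  mesh_ct G H n k - mesh_ct G H n.+1 k.
Proof.
by rewrite /mesh_ct mesh_c_decrement mesh_d_decrement mesh_e_decrement; ring.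
Qed.

(** * Bounds on the coefficients of a convex kernel *)

Section kernel.
Variables k g G H : R -> R.
Hypothesis gP : convex_kernel k g G H.

Let cell n j : (0 < j < n)%N -> (n <= N)%N ->
  0 < t n - t j /\ t n - t j < t n - t j.-1.
Proof.
by move=> jn nN; rewrite subr_gt0 ltrD2l ltrN2 !mesh_lt//; lia.
Qed.

Lemma mesh_d_ge0 n j : (0 < j < n)%N -> (n <= N)%N -> 0 <= mesh_d G H n j.
Proof. by move=> jn nN; have [? ?] := cell jn nN; exact: (cell_d_ge0 gP). Qed.

Lemma mesh_e_ge0 n j : (0 < j <= n)%N -> (n <= N)%N -> 0 <= mesh_e G H n j.
Proof.
move=> jn nN; rewrite /mesh_e; case: ifP => // j2.
have r1 : 1 <= rho j by apply: rho_ge1; lia.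
by rewrite divr_ge0 ?mesh_d_ge0// ?mulr_ge0; [lia|lra..].
Qed.

(** Cell j - 1 is farther from t_n and no wider than cell j, so its moment is no larger. *)
Lemma mesh_e_le n j : (0 < j < n)%N -> (n <= N)%N ->
  mesh_e G H n j <= mesh_d G H n j.
Proof.
move=> jn nN; rewrite /mesh_e; case: ifP => j2; last exact: mesh_d_ge0.
have r1 : 1 <= rho j by apply: rho_ge1; lia.
have jn' : (0 < j.-1 < n)%N by lia.
apply: (@le_trans _ _ (mesh_d G H n j.-1)).
  by rewrite ler_pdivrMr ?ler_peMr ?mesh_d_ge0//; nra.
have [? ?] := cell jn nN; have [_ ?] := cell jn' nN.
apply: (cell_d_nincr gP) => //.
have := @nabla_le j.-1; rewrite /nabla prednK; last by lia.
by move=> /(_ _)/wrap[]; [lia|lra].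
Qed.

(** By [mesh_e_le] the coefficient is at most c + d; symmetrically it is at least c - d. The
    condition j < n keeps the cell away from the singularity of [g]. *)
Lemma mesh_ct_le n j : (0 < j < n)%N -> (n <= N)%N ->
  mesh_ct G H n j <= g (t n - t j).
Proof.
move=> jn nN; have [j0 jj] := cell jn nN.
have r1 : 1 <= rho j.+1 by apply: rho_ge1; lia.
have := cell_cDd_le gP j0 jj; have := mesh_e_le jn nN.
have : 0 <= mesh_d G H n j / (1 + rho j.+1).
  by rewrite divr_ge0 ?mesh_d_ge0//; lra.
rewrite /mesh_ct /mesh_c /mesh_d; lra.
Qed.

Lemma mesh_ct_ge n j : (0 < j < n)%N -> (n <= N)%N ->
  g (t n - t j.-1) <= mesh_ct G H n j.
Proof.
move=> jn nN; have [j0 jj] := cell jn nN.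
have r1 : 1 <= rho j.+1 by apply: rho_ge1; lia.
have := cell_cBd_ge gP j0 jj.
have : 0 <= mesh_e G H n j by apply: mesh_e_ge0 => //; lia.
have : mesh_d G H n j / (1 + rho j.+1) <= mesh_d G H n j.
  by rewrite ler_pdivrMr ?ler_peMr ?mesh_d_ge0//; lra.
rewrite /mesh_ct /mesh_c /mesh_d; lra.
Qed.

Lemma mesh_ct_ge0 n j : (0 < j < n)%N -> (n <= N)%N -> 0 <= mesh_ct G H n j.
Proof.
move=> jn nN; apply: le_trans (mesh_ct_ge jn nN).
have [_ _ _ gk _] := gP; have [] // := gk (t n - t j.-1).
by have [] := cell jn nN; exact: lt_trans.
Qed.

(** The value of [g] at the shared node t_j separates the two coefficients. *)
Lemma mesh_ct_ndecr n j : (0 < j)%N -> (j.+1 < n <= N)%N ->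
  mesh_ct G H n j <= mesh_ct G H n j.+1.
Proof.
move=> j0 /andP[jn nN].
apply: (@le_trans _ _ (g (t n - t j))); first by apply: mesh_ct_le => //; lia.
by apply: (@mesh_ct_ge n j.+1) => //; lia.
Qed.

End kernel.

(** * The L2 coefficients and the constant theta *)

Variables alpha rbar : R.
Hypothesis alpha01 : 0 < alpha < 1.
Hypothesis rbar_ge4 : 4 <= rbar.

Local Notation g3 := (Gamma (3 - alpha)).
Local Notation gf := (pow_g alpha).
Local Notation Gf := (pow_G alpha).
Local Notation Hf := (pow_H alpha).
Local Notation th := (theta rbar alpha).

(** The argument 3 - alpha exceeds 2, so one step of the recurrence brings it into the range of
    [Gamma_gt0]. *)
Lemma Gamma3_gt0 : 0 < g3.
Proof.
have /andP[a0 a1] := alpha01.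
have -> : 3 - alpha = (2 - alpha) + 1 by ring.
rewrite GammaD1; last by lra.
by rewrite mulr_gt0 ?Gamma_gt0; lra.
Qed.

Lemma Gamma2E : Gamma (2 - alpha) = g3 / (2 - alpha).
Proof.
have /andP[a0 a1] := alpha01.
have -> : 3 - alpha = (2 - alpha) + 1 by ring.
rewrite GammaD1; last by lra.
by rewrite mulrAC divff ?mul1r//; lra.
Qed.

Lemma nabla_neq0 k : (0 < k <= N)%N -> nabla t k != 0.
Proof. by move=> kN; rewrite gt_eqF// (nabla_gt0). Qed.

Let cell_width n k : t n - t k.-1 - (t n - t k) = nabla t k.
Proof. by rewrite /nabla; ring. Qed.

Lemma c_coefE n k : (0 < k <= n)%N -> (n <= N)%N ->
  c_coef alpha t n (n - k) = mesh_c Gf n k / g3.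
Proof.
have /andP[a0 a1] := alpha01.
move=> /andP[k0 kn] nN; rewrite /c_coef subKn// Gamma2E /mesh_c /cell_c cell_width /pow_G.
have := Gamma3_gt0 => g0; field.
by rewrite nabla_neq0 ?k0 ?(leq_trans kn)//= gt_eqF//; lra.
Qed.

Lemma d_coefE n k : (0 < k <= n)%N -> (n <= N)%N ->
  d_coef alpha t n (n - k) = mesh_d Gf Hf n k / g3.
Proof.
have /andP[a0 a1] := alpha01.
move=> /andP[k0 kn] nN; rewrite /d_coef subKn// Gamma2E /mesh_d /cell_d cell_width.
rewrite /pow_G /pow_H.
have := Gamma3_gt0 => g0; field.
by rewrite nabla_neq0 ?k0 ?(leq_trans kn)//= gt_eqF//; lra.
Qed.

Lemma mesh_c_last n : (0 < n <= N)%N ->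
  mesh_c Gf n n = (2 - alpha) * nabla t n `^ (- alpha).
Proof.
have /andP[a0 a1] := alpha01.
move=> nN; rewrite /mesh_c /cell_c cell_width subrr /pow_G powR0; last by lra.
rewrite mulr0 subr0 -/(nabla t n).
have tn := nabla_gt0 nN.
rewrite powRD; last by apply/implyP => _; rewrite gt_eqF.
by rewrite powRr1 ?(ltW tn)//; field; rewrite gt_eqF.
Qed.

Lemma mesh_d_last n : (0 < n <= N)%N ->
  mesh_d Gf Hf n n = alpha * nabla t n `^ (- alpha).
Proof.
have /andP[a0 a1] := alpha01.
move=> nN; rewrite /mesh_d /cell_d cell_width subrr /pow_G /pow_H !powR0; [|lra..].
rewrite mulr0 subr0 addr0 -/(nabla t n).
have -> : 2 - alpha = 1 + (1 - alpha) by ring.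
have tn := nabla_gt0 nN.
rewrite !powRD; [|by apply/implyP => _; rewrite gt_eqF..].
by rewrite powRr1 ?(ltW tn)//; field; rewrite gt_eqF.
Qed.

(** The parts theta c_0 and d_0 of the last cell are set aside for the local energy. *)
Definition mesh_ct0 n :=
  (1 - th) * mesh_c Gf n n + mesh_e Gf Hf n n.

Lemma ctilde0E n : (0 < n <= N)%N -> ctilde alpha rbar t rho n 0 = mesh_ct0 n / g3.
Proof.
move=> nN; have c0 := c_coefE (n := n) (k := n); rewrite subnn in c0.
rewrite /ctilde /mesh_ct0 /mesh_e; case: (altP (n =P 1%N)) => [n1|n1].
  by move: c0; rewrite n1 => ->; rewrite ?addr0 ?mulrA//; lia.
have -> : (0 == n.-1)%N = false by lia.
have -> : (2 <= n)%N by lia.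
have d1 := d_coefE (n := n) (k := n.-1).
rewrite (_ : n - n.-1 = 1)%N in d1; last by lia.
by rewrite /= c0 ?d1; [ring|lia..].
Qed.

Lemma ctildeE n k : (0 < k < n)%N -> (n <= N)%N ->
  ctilde alpha rbar t rho n (n - k) = mesh_ct Gf Hf n k / g3.
Proof.
move=> kn nN; have -> : ctilde alpha rbar t rho n (n - k) =
    c_coef alpha t n (n - k)
    + (if (2 <= k)%N then d_coef alpha t n (n - k.-1) / (rho k * (1 + rho k)) else 0)
    - d_coef alpha t n (n - k) / (1 + rho k.+1).
  rewrite /ctilde subKn; last by lia.
  have -> : (n == 1)%N = false by lia.
  have -> : (n - k == 0)%N = false by lia.
  have -> : (n - k == n.-1)%N = ~~ (2 <= k)%N by lia.
  case: ifP => [|/negbFE] k2.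
    by rewrite (negbTE k2) addr0; have -> : k = 1%N by lia.
  by rewrite k2; have -> : (n - k.-1 = (n - k).+1)%N by lia.
rewrite /mesh_ct /mesh_e c_coefE ?(d_coefE (k := k)); [|lia..].
case: ifP => k2; last by ring.
by rewrite d_coefE; [ring|lia..].
Qed.

(** The right side is 2(1 - alpha) - kappa/(1 + rbar), where kappa <= alpha - alpha^3 by [powR2_le]
    and 1 + rbar >= 5. With [powR2N_ge] for the left side, a factor 1 - alpha splits off and a
    polynomial inequality remains. *)
Lemma theta_upper :
  (1 - alpha) * (2 - alpha) * (1 + (1 - 2 `^ (- alpha)) / 2) <=
  2 * (1 - th) * (2 - alpha).
Proof.
have /andP[a0 a1] := alpha01.
have h1 := powR2_le alpha01; have h2 := powR2N_ge alpha01.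
have n1 : 2 - alpha != 0 by lra.
have r4 := rbar_ge4; have n2 : 1 + rbar != 0 by lra.
have [kappa kappaE] : {kappa | kappa =
    2 `^ (1 - alpha) * alpha ^+ 2 + alpha - 2 * alpha ^+ 2} by eexists.
have -> : 2 * (1 - th) * (2 - alpha) = 2 * (1 - alpha) - kappa / (1 + rbar).
  by rewrite /theta kappaE; field; rewrite n1 n2.
have kappa_le : kappa <= alpha - alpha ^+ 3 by rewrite kappaE; nra.
clear kappaE.
have : kappa / (1 + rbar) <= (alpha - alpha ^+ 3) / 5.
  have p0 : 0 <= alpha - alpha ^+ 3.
    have -> : alpha - alpha ^+ 3 = alpha * (1 - alpha) * (1 + alpha) by ring.
    by rewrite !mulr_ge0//; lra.
  rewrite ler_pdivrMr; last by lra.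
  apply: le_trans kappa_le _.
  rewrite -mulrA ler_peMr// ler_pdivlMl//; lra.
move=> kle; apply: le_trans (_ : 2 * (1 - alpha) - (alpha - alpha ^+ 3) / 5 <= _);
  last by lra.
have : (2 - alpha) * (1 + (1 - 2 `^ (- alpha)) / 2) <= 2 - (alpha + alpha ^+ 2) / 5.
  by nra.
have -> : 2 * (1 - alpha) - (alpha - alpha ^+ 3) / 5 =
  (1 - alpha) * (2 - (alpha + alpha ^+ 2) / 5) by field.
by move=> H; rewrite -mulrA ler_wpM2l//; lra.
Qed.

(** [theta_upper] times tau_n^(-alpha). The half decrement is the margin that the comparison of last
    increments in [increments_mesh_J_nincr] consumes. *)
Lemma mesh_c_last_ge n : (0 < n <= N)%N ->
  gf (nabla t n) + decrement gf (nabla t n) (nabla t n) / 2 <=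
  2 * (1 - th) * mesh_c Gf n n.
Proof.
move=> nN; have tn := nabla_gt0 nN.
have tE : (nabla t n + nabla t n) `^ (- alpha) =
    2 `^ (- alpha) * nabla t n `^ (- alpha).
  by rewrite -powRM ?(ltW tn)// mulr_natl mulr2n.
rewrite mesh_c_last// /decrement /pow_g tE.
set p := nabla t n `^ _; have p0 : 0 <= p by exact: powR_ge0.
have := ler_wpM2r p0 theta_upper; lra.
Qed.

(** * Sign and monotonicity of the history weights *)

Local Notation kf := (pow_kernel alpha01).
Local Notation kfd h := (pow_kernel_decrement alpha01 h).

Definition mesh_J n k := if k == n then 2 * mesh_ct0 n else mesh_ct Gf Hf n k.

Lemma JE n k : (0 < k <= n)%N -> (n <= N)%N ->
  J alpha rbar t rho n (n - k) = mesh_J n k / g3.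
Proof.
move=> kn nN; rewrite /J /mesh_J (_ : (n - k == 0)%N = (k == n)); last by lia.
case: eqP => [_|kn'].
  by rewrite ctilde0E; [ring|lia].
by rewrite ctildeE//; lia.
Qed.

Lemma gf_ge0 x : 0 < x -> 0 <= gf x.
Proof. by have [_ _ _ gk _] := kf => /gk[]. Qed.

Lemma gf_decrement_ge0 h x : 0 <= h -> 0 < x -> 0 <= decrement gf h x.
Proof. by move=> h0; have [_ _ _ gk _] := kfd h0 => /gk[]. Qed.

Lemma mesh_ct0_ge n : (0 < n <= N)%N -> gf (nabla t n) <= 2 * mesh_ct0 n.
Proof.
move=> nN; have tn := nabla_gt0 nN.
have := mesh_c_last_ge nN; have := gf_decrement_ge0 (ltW tn) tn.
have : 0 <= mesh_e Gf Hf n n by apply: (mesh_e_ge0 kf); lia.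
rewrite /mesh_ct0; lra.
Qed.

Lemma increments_mesh_J_ge0 n j : (j < n <= N)%N -> 0 <= increments (mesh_J n) j.
Proof.
move=> jn; rewrite /increments /mesh_J.
have nN : (0 < n <= N)%N by lia.
have tn := nabla_gt0 nN; have ct0 := mesh_ct0_ge nN.
have g0 := gf_ge0 tn.
(* If j + 1 = n, the doubled [mesh_ct0] enters and g(tau_n) separates the two terms. If j = 0, the
   increment is a single coefficient. *)
have [jn1|jn1] := eqVneq j.+1 n; case: j jn1 jn => [|j] jn1 jn.
- by rewrite subr0; apply: le_trans ct0.
- rewrite ifN; last by lia.
  rewrite subr_ge0; apply: le_trans ct0.
  have := mesh_ct_le kf (n := n) (j := j.+1).
  have -> : t n - t j.+1 = nabla t n by rewrite -jn1.
  by apply; lia.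
- by rewrite subr0; apply: (mesh_ct_ge0 kf); lia.
- rewrite ifN; last by lia.
  by rewrite subr_ge0; apply: (mesh_ct_ndecr kf); lia.
Qed.

(** For j + 1 < n this is nonnegativity of the increments for the decrement kernel. The case j + 1 =
    n rests on the value of theta. *)
Lemma increments_mesh_J_nincr n j : (j < n < N)%N ->
  increments (mesh_J n.+1) j <= increments (mesh_J n) j.
Proof.
move=> jn; rewrite /increments /mesh_J.
have nN : (0 < n <= N)%N by lia.
have nn : (0 < n <= n)%N by lia.
have nn1 : (0 < n < n.+1)%N by lia.
have nN' : (n <= N)%N by lia.
have n1N' : (n.+1 <= N)%N by lia.
have r1 : 1 <= rho n.+1 by apply: rho_ge1; lia.
have n1N : (0 < n.+1 <= N)%N by lia.
have tn := nabla_gt0 nN; have tn1 := nabla_gt0 n1N.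
have tnn : nabla t n <= nabla t n.+1 by apply: (nabla_le); lia.
have ct0 := mesh_ct0_ge nN.
have kd := kfd (ltW tn1).
have [jn1|jn1] := eqVneq j.+1 n; case: j jn1 jn => [|j] jn1 jn.
- rewrite ifN; last by lia.
  rewrite !subr0; apply: le_trans ct0.
  apply: le_trans (convex_kernel_nincr kf tn tnn).
  have := mesh_ct_le kf (n := n.+1) (j := 1%N).
  have -> : t n.+1 - t 1%N = nabla t n.+1 by rewrite /nabla /= -jn1.
  by apply; lia.
(* Put h = tau_n, h' = tau_(n+1). The loss at k = n - 1 is at most g(h) - g(h + h'), and the
   trapezoid bounds c at (n+1, n) by (g(h') + g(h + h'))/2. Their sum g(h) + (g(h') - g(h + h'))/2
   is at most g(h) + (g(h) - g(2h))/2, which [mesh_c_last_ge] provides. *)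
- have jn' : (0 < j.+1 < n)%N by lia.
  do 3 (rewrite ifN; last by lia).
  have d1 := mesh_ct_le kd (n := n) (j := j.+1).
  rewrite mesh_ct_decrement in d1.
  have tj : t n - t j.+1 = nabla t n by rewrite -jn1.
  rewrite tj in d1; have {}d1 := d1 jn' nN'.
  have c1 := mesh_c_last_ge nN.
  have tr := cell_c_trapezoid kf tn1 (y := nabla t n.+1 + nabla t n).
  rewrite ltrDl in tr; have {}tr := tr tn.
  have cE : mesh_c Gf n.+1 n = cell_c Gf (nabla t n.+1) (nabla t n.+1 + nabla t n).
    by rewrite /mesh_c; congr cell_c; rewrite /nabla/=; ring.
  have dd := convex_kernel_nincr (kfd (ltW tn)) tn tnn.
  have e0 := mesh_e_ge0 kf nn nN'.
  have ed := mesh_e_ge0 kd nn nN'.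
  rewrite mesh_e_decrement in ed.
  have d0 : 0 <= mesh_d Gf Hf n.+1 n / (1 + rho n.+1).
    by rewrite divr_ge0 ?(mesh_d_ge0 kf)//; lra.
  have ctE : mesh_ct Gf Hf n.+1 n = mesh_c Gf n.+1 n
    + mesh_e Gf Hf n.+1 n - mesh_d Gf Hf n.+1 n / (1 + rho n.+1) by [].
  rewrite jn1 ctE /mesh_ct0 cE.
  move: d1 c1 tr dd; rewrite /decrement (addrC (nabla t n)); lra.
- rewrite ifN; last by lia.
  rewrite !subr0 -subr_ge0 -mesh_ct_decrement.
  by apply: (mesh_ct_ge0 kd); lia.
- have j1 : (0 < j.+1)%N by [].
  have jn' : (j.+2 < n <= N)%N by lia.
  do 3 (rewrite ifN; last by lia).
  rewrite lerBlDr addrAC -lerBlDr -subr_ge0.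
  have := mesh_ct_ndecr kd (n := n) (j := j.+1).
  rewrite !mesh_ct_decrement => /(_ j1 jn'); lra.
Qed.

(** * Energy estimate *)

Variable w : nat -> R.

Local Notation mct := (mesh_ct Gf Hf).
Local Notation mct0 := mesh_ct0.

Definition local_energy n :=
  alpha * rho n.+1 `^ (2 - alpha / 2) * nabla w n ^+ 2
  / (2 * (1 + rho n.+1) * nabla t n `^ alpha).

Lemma energyE n : (0 < n <= N)%N -> energy alpha rbar t rho w n =
  (local_energy n + 2^-1 *
    \sum_(0 <= j < n) increments (mesh_J n) j * (w n - w j) ^+ 2) / g3.
Proof.
move=> nN; have g0 := Gamma3_gt0.
have n0 : (0 < n)%N by lia.
have nN' : (n <= N)%N by lia.
have nn : (0 < 1 <= n)%N by lia.
have r1 : 1 <= rho n.+1 by apply: rho_ge1; lia.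
rewrite /energy -addrA [in RHS]mulrDl; congr (_ + _).
  have tn : 0 < nabla t n `^ alpha by rewrite powR_gt0// (nabla_gt0).
  by rewrite /local_energy; field; rewrite !gt_eqF//; lra.
rewrite [in RHS]big_ltn//.
have -> : J alpha rbar t rho n n.-1 = mesh_J n 1%N / g3.
  by rewrite -(JE nn nN') subn1.
have -> : \sum_(1 <= j < n)
      (J alpha rbar t rho n (n - j - 1) - J alpha rbar t rho n (n - j))
      * (w n - w j) ^+ 2 =
    (\sum_(1 <= j < n) increments (mesh_J n) j * (w n - w j) ^+ 2) / g3.
  rewrite mulr_suml; apply: eq_big_nat => j jn.
  have j1n : (0 < j.+1 <= n)%N by lia.
  have jn' : (0 < j <= n)%N by lia.
  rewrite -subnDA addn1 (JE j1n nN').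
  rewrite (JE jn' nN').
  by rewrite /increments; case: j jn {j1n jn'} => [|j] jn; [|ring].
rewrite /increments subr0; ring.
Qed.

Lemma caputo_L2E n : (2 <= n <= N)%N ->
  caputo_L2 alpha t rho w n =
  (\sum_(1 <= k < n.+1) (if k == n then mct0 n else mct n k) * nabla w k
   + th * mesh_c Gf n n * nabla w n
   + rho n / (1 + rho n) * mesh_d Gf Hf n n
     * (nabla w n - rho n * nabla w n.-1)) / g3.
Proof.
move=> nN; have nN' : (n <= N)%N by lia.
have nn : (0 < n <= n)%N by lia.
have n0 : (0 < n)%N by lia.
have n1 : (n == 1)%N = false by lia.
have nS : (1 <= n)%N by lia.
have d0 := d_coefE nn nN'.
rewrite subnn in d0; rewrite /caputo_L2 n1 d0.
have -> : \sum_(1 <= k < n.+1) c_coef alpha t n (n - k) * nabla w k =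
    (\sum_(1 <= k < n.+1) mesh_c Gf n k * nabla w k) / g3.
  rewrite mulr_suml; apply: eq_big_nat => k kn.
  by rewrite (c_coefE kn nN'); ring.
have -> : \sum_(1 <= k < n) d_coef alpha t n (n - k)
      * ((nabla w k.+1 - rho k.+1 * nabla w k) / (rho k.+1 * (1 + rho k.+1))) =
    (\sum_(1 <= k < n.+1) mesh_e Gf Hf n k * nabla w k
     - \sum_(1 <= k < n) mesh_d Gf Hf n k / (1 + rho k.+1) * nabla w k) / g3.
  (* As [mesh_e] vanishes at k = 1, its sum can be reindexed by k + 1: the second difference of cell
     k feeds v_(k+1) through [mesh_e] and v_k through - d / (1 + rho). *)
  rewrite (@big_ltn _ _ _ 1 n.+1)// {1}/mesh_e mul0r add0r big_add1/=.
  rewrite -sumrB mulr_suml; apply: eq_big_nat => k kn.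
  have r1 : 1 <= rho k.+1 by apply: rho_ge1; lia.
  have kn' : (0 < k <= n)%N by lia.
  have k2 : (1 < k.+1)%N by lia.
  rewrite (d_coefE kn' nN') /mesh_e k2 /=.
  have g0 := Gamma3_gt0.
  by field; rewrite !gt_eqF//; lra.
have -> : \sum_(1 <= k < n.+1) (if k == n then mct0 n else mct n k) * nabla w k =
    \sum_(1 <= k < n.+1) mesh_c Gf n k * nabla w k
    + (\sum_(1 <= k < n.+1) mesh_e Gf Hf n k * nabla w k
     - \sum_(1 <= k < n) mesh_d Gf Hf n k / (1 + rho k.+1) * nabla w k)
    - th * mesh_c Gf n n * nabla w n.
  do 3 (rewrite big_nat_recr //=).
  rewrite eqxx.
  have -> : \sum_(1 <= k < n) (if k == n then mct0 n else mct n k) * nabla w k =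
      \sum_(1 <= k < n) mesh_c Gf n k * nabla w k
      + \sum_(1 <= k < n) mesh_e Gf Hf n k * nabla w k
      - \sum_(1 <= k < n) mesh_d Gf Hf n k / (1 + rho k.+1) * nabla w k.
    rewrite -big_split -sumrB; apply: eq_big_nat => k /andP[_ kn].
    by rewrite ltn_eqF// /mesh_ct/=; ring.
  by rewrite /mesh_ct0; ring.
ring.
Qed.

Lemma energy_ge0 n : (0 < n <= N)%N -> 0 <= energy alpha rbar t rho w n.
Proof.
move=> nN; have g0 := Gamma3_gt0; have /andP[a0 a1] := alpha01.
have r1 : 1 <= rho n.+1 by apply: rho_ge1; lia.
have /andP[_ nN'] := nN.
rewrite energyE// divr_ge0 ?(ltW g0)// addr_ge0//.
  rewrite /local_energy divr_ge0//.
    by rewrite mulr_ge0 ?sqr_ge0// mulr_ge0 ?powR_ge0 ?(ltW a0).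
  by rewrite mulr_ge0 ?powR_ge0// mulr_ge0//; lra.
rewrite mulr_ge0// big_nat sumr_ge0// => j jn; rewrite mulr_ge0 ?sqr_ge0//.
by apply: (increments_mesh_J_ge0); rewrite nN' andbT.
Qed.

(** Summation by parts for [mesh_J n.+1], whose extra square undoes the doubling of the last
    coefficient. Weights in front of -(w^n - w^j)^2 may then be raised from level n + 1 to level
    n. *)
Lemma history_energy_le n : (1 <= n < N)%N ->
  \sum_(0 <= j < n.+1) increments (mesh_J n.+1) j * (w n.+1 - w j) ^+ 2
  - \sum_(0 <= j < n) increments (mesh_J n) j * (w n - w j) ^+ 2 <=
  2 * nabla w n.+1 *
    \sum_(1 <= k < n.+2) (if k == n.+1 then mct0 n.+1 else mct n.+1 k) * nabla w k.
Proof.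
move=> /andP[n0 nN].
have -> : 2 * nabla w n.+1 *
    \sum_(1 <= k < n.+2) (if k == n.+1 then mct0 n.+1 else mct n.+1 k) * nabla w k =
    \sum_(0 <= j < n.+1)
      increments (mesh_J n.+1) j * ((w n.+1 - w j) ^+ 2 - (w n - w j) ^+ 2).
  have := sum_nabla_by_parts (mesh_J n.+1) w n.
  rewrite [\sum_(1 <= k < _) mesh_J _ _ * _]big_nat_recr//=.
  rewrite [in X in _ -> X = _]big_nat_recr//= eqxx.
  have -> : mesh_J n.+1 n.+1 = 2 * mct0 n.+1 by rewrite /mesh_J eqxx.
  have -> : \sum_(1 <= k < n.+1) mesh_J n.+1 k * nabla w k =
      \sum_(1 <= k < n.+1) (if k == n.+1 then mct0 n.+1 else mct n.+1 k) * nabla w k.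
    by apply: eq_big_nat => k /andP[_ kn]; rewrite /mesh_J !ltn_eqF.
  lra.
rewrite big_nat_recr//= [leRHS]big_nat_recr//= subrr expr0n/= subr0.
rewrite lerBlDr addrAC lerD2r -big_split/= big_nat [leRHS]big_nat.
apply: ler_sum => j /andP[_ jn].
have : increments (mesh_J n.+1) j <= increments (mesh_J n) j.
  by apply: (increments_mesh_J_nincr); rewrite jn.
have := sqr_ge0 (w n - w j); nra.
Qed.

(** With r = rho_(n+1), Q = r^(2-alpha/2) and v, u the last two differences, right minus left is
    exactly alpha (Q v - r^2 u)^2 / ((1 + r) tau_(n+1)^alpha Q). *)
Lemma local_energy_le n : (1 <= n < N)%N ->
  2 * (local_energy n.+1 - local_energy n)
  + q rbar (rho n.+1) (rho n.+2) alpha * nabla w n.+1 ^+ 2 / nabla t n.+1 `^ alpha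
  <= 2 * nabla w n.+1 * (th * mesh_c Gf n.+1 n.+1 * nabla w n.+1
   + rho n.+1 / (1 + rho n.+1) * mesh_d Gf Hf n.+1 n.+1
     * (nabla w n.+1 - rho n.+1 * nabla w n)).
Proof.
move=> nN; have /andP[a0 a1] := alpha01.
have n1N : (0 < n.+1 <= N)%N by lia.
have r1 : 1 <= rho n.+1 by apply: rho_ge1; lia.
have r2 : 1 <= rho n.+2 by apply: rho_ge1; lia.
have r0 : 0 < rho n.+1 by lra.
have tn : 0 < nabla t n by apply: (nabla_gt0); lia.
have tn1 : 0 < nabla t n.+1 by apply: (nabla_gt0).
have tE : nabla t n.+1 = rho n.+1 * nabla t n.
  have n2 : (2 <= n.+1 <= N)%N by lia.
  by rewrite rhoE//= divfK// gt_eqF.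
rewrite (mesh_c_last)// (mesh_d_last)//.
have TE : nabla t n.+1 `^ alpha = rho n.+1 `^ alpha * nabla t n `^ alpha.
  by rewrite tE powRM// ltW.
rewrite powRN /local_energy /q.
have T1 : 0 < nabla t n `^ alpha by rewrite powR_gt0.
have P0 : 0 < rho n.+1 `^ alpha by rewrite powR_gt0.
have Q0 : 0 < rho n.+1 `^ (2 - alpha / 2) by rewrite powR_gt0.
(* This identity explains the exponent 2 - alpha/2: with it the u^2 term of the square is the
   previous local energy. *)
have QE : (rho n.+1 `^ (2 - alpha / 2)) ^+ 2 * rho n.+1 `^ alpha = rho n.+1 ^+ 4.
  rewrite -powR_mulrn ?powR_ge0// -powRrM -powRD; last first.
    by apply/implyP => _; rewrite gt_eqF.
  by rewrite -powR_mulrn ?(ltW r0)//; congr (_ `^ _); field.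
rewrite TE; move: T1 P0 Q0 QE.
move: (nabla t n `^ _) (rho n.+1 `^ alpha).
move: (rho n.+1 `^ (2 - alpha / 2)) (rho n.+2 `^ _).
move: r1 r2 r0; move: (nabla w n.+1) (nabla w n).
move: (rho n.+1) (rho n.+2) th.
move=> r y h v u r1 r2 r0 Q Q2 T1 P T0 P0 Q0 QE.
rewrite -subr_ge0.
have : 0 <= alpha / ((1 + r) * (P * T1) * Q) * (Q * v - r ^+ 2 * u) ^+ 2.
  have yr : 0 < 1 + r by lra.
  have D0 : 0 < (1 + r) * (P * T1) * Q by rewrite !mulr_gt0.
  by rewrite mulr_ge0 ?sqr_ge0// divr_ge0 ?(ltW a0) ?(ltW D0).
move=> /le_trans; apply.
rewrite le_eqVlt; apply/orP; left; apply/eqP.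
have -> : (Q * v - r ^+ 2 * u) ^+ 2 =
   Q * (Q * v ^+ 2 - 2 * r ^+ 2 * v * u + Q * P * u ^+ 2).
  by rewrite sqrrB [(r ^+ 2 * u) ^+ 2]exprMn -exprM -QE; ring.
by rewrite /=; field; rewrite !gt_eqF//; lra.
Qed.

(** Half the sum of [history_energy_le] and [local_energy_le], divided by Gamma(3 - alpha). *)
Lemma caputo_energy_le n : (2 <= n <= N)%N ->
  energy alpha rbar t rho w n - energy alpha rbar t rho w n.-1
  + q rbar (rho n) (rho n.+1) alpha * nabla w n ^+ 2
    / (2 * nabla t n `^ alpha * Gamma (3 - alpha)) <=
  caputo_L2 alpha t rho w n * nabla w n.
Proof.
case: n => // n nN; have g0 := Gamma3_gt0.
have n1N : (1 <= n < N)%N by lia.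
have n1N' : (0 < n.+1 <= N)%N by lia.
have nN' : (0 < n <= N)%N by lia.
have tn : 0 < nabla t n.+1 `^ alpha by rewrite powR_gt0// (nabla_gt0).
have hist := history_energy_le n1N.
have loc := local_energy_le n1N.
rewrite (energyE n1N') [n.+1.-1]/= (energyE nN') (caputo_L2E nN).
have -> : q rbar (rho n.+1) (rho n.+2) alpha * nabla w n.+1 ^+ 2
    / (2 * nabla t n.+1 `^ alpha * Gamma (3 - alpha)) =
  q rbar (rho n.+1) (rho n.+2) alpha * nabla w n.+1 ^+ 2
    / nabla t n.+1 `^ alpha / 2 / Gamma (3 - alpha).
  by field; rewrite !gt_eqF.
rewrite -mulrBl -mulrDl [leRHS]mulrAC ler_pM2r ?invr_gt0//.
move: hist loc; rewrite /=; lra.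
Qed.

End mesh.

Theorem theorem2p6 (R : realType) (alpha rbar rstar T : R) (N : nat)
    (t rho : nat -> R) :
  0 < alpha < 1 ->
  is_rho_bar rbar ->
  is_rho_star alpha rstar ->
  time_mesh T N t ->
  step_ratios N t rho ->
  (forall n, (2 <= n <= N.+1)%N -> 1 <= rho n <= rstar) ->
  forall w : nat -> R,
    (forall n, (1 <= n <= N)%N -> 0 <= energy alpha rbar t rho w n) /\
    (forall n, (2 <= n <= N)%N ->
      caputo_L2 alpha t rho w n * nabla w n >=
      energy alpha rbar t rho w n - energy alpha rbar t rho w n.-1
      + q rbar (rho n) (rho n.+1) alpha * nabla w n ^+ 2
        / (2 * nabla t n `^ alpha * Gamma (3 - alpha))).
Proof.
move=> alpha01 [a [_ _ rbarP _]] _ [_ _ t_incr] rhoE rhoP w.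
(* The numerical window around 4.7476114 gives the bound used in [theta_upper]. *)
have rbar_ge4 : 4 <= rbar by move: rbarP; rewrite ltr_norml => /andP[]; lra.
have rho_ge1 k : (2 <= k <= N.+1)%N -> 1 <= rho k by move=> /rhoP/andP[].
split=> n nN; first exact: (energy_ge0 t_incr rhoE rho_ge1).
exact: (caputo_energy_le t_incr rhoE rho_ge1).
Qed.
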